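(* Let $(T,X)$ be an invertible semiflow on a compact Hausdorff space $X$, where $T$ is a $C$-semigroup, not necessarily discrete. Then $(T,X)$ is minimal if and only if its reflection $(X,T)$ is minimal.
   Context: $X$ is a nonempty compact Hausdorff space. $T$ is a topological semigroup: a Hausdorff space with jointly continuous associative multiplication and identity $e$. $T$ is a $C$-semigroup if $T\setminus sT$ and $T\setminus Ts$ are relatively compact in $T$ for every $s\in T$. A semiflow $(T,X)$ is a jointly continuous map $T\times X\to X$, $(t,x)\mapsto tx$, with $ex=x$ and $t(sx)=(ts)x$. It is invertible if each map $x\mapsto tx$ is a bijection (hence a homeomorphism) of $X$; the reflection $(X,T)$ is the right action $(x,t)\mapsto xt:=t^{-1}x$. $(T,X)$ is minimal if $\{tx:t\in T\}$ is dense in $X$ for every $x\in X$; $(X,T)$ is minimal if $\{t^{-1}x:t\in T\}$ is dense in $X$ for every $x\in X$. *)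

(* Defs.v *)
From HB Require Import structures.
From mathcomp Require Import all_boot.
From mathcomp Require Import boolp classical_sets functions topology.

Set Implicit Arguments.
Unset Strict Implicit.
Unset Printing Implicit Defensive.

Local Open Scope classical_set_scope.

(* As in the source, a topological semigroup is Hausdorff and has an identity;
   no inverses, commutativity or cancellation are assumed. *)
HB.mixin Record isTopologicalSemigroup T
    & Topological T & monoid.Monoid T := {
  mulg_continuous : continuous (fun p : T * T => (p.1 * p.2)%g) ;
  topsemigroup_hausdorff : hausdorff_space T ;
}.

#[short(type="topologicalSemigroupType")]
HB.structure Definition TopologicalSemigroup :=
  {T of Topological T & monoid.Monoid T & isTopologicalSemigroup T}.

(* [precompact A] is equivalent to [compact (closure A)], see [precompactE]. *)
Definition C_semigroup (T : topologicalSemigroupType) : Prop :=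
  forall s : T,
    precompact ([set: T] `\` [set (s * t)%g | t in [set: T]]) /\
    precompact ([set: T] `\` [set (t * s)%g | t in [set: T]]).

Section Semiflow.
Context {T : topologicalSemigroupType} {X : topologicalType}.
Implicit Type act : T -> X -> X.

Record semiflow act : Prop := Semiflow {
  semiflow_continuous : continuous (fun p : T * X => act p.1 p.2) ;
  semiflow1 : forall x, act 1%g x = x ;
  semiflowM : forall t s x, act t (act s x) = act (t * s)%g x
}.

Definition invertible act : Prop := forall t, bijective (act t).

(* x t := t^-1 x; the default [id] of the partial inverse is never used when
   [act] is invertible, see [reflectionK] and [reflectionVK]. *)
Definition reflection act : X -> T -> X :=
  fun x t => 'pinv_id [set: X] (act t) x.

Lemma reflectionK act : invertible act ->
  forall t x, act t (reflection act x t) = x.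
Proof.
move=> inv t x; have [g gK Kg] := inv t.
by apply: pinvK; apply/mem_set; exists (g x) => //; exact: Kg.
Qed.

Lemma reflectionVK act : invertible act ->
  forall t x, reflection act (act t x) t = x.
Proof.
move=> inv t x; apply: pinvKV; last exact/mem_set.
by move=> y z _ _; exact: bij_inj (inv t) y z.
Qed.

Definition minimal act : Prop :=
  forall x, dense [set act t x | t in [set: T]].

Definition right_minimal (ract : X -> T -> X) : Prop :=
  forall x, dense [set ract x t | t in [set: T]].

End Semiflow.

(* Main.v *)
(** If [T] is not compact, finitely many ideals [t T] (or [T t]) always meet,
    since the union of their relatively compact complements is not [T].
    Suppose that every [T]-orbit is dense, let [O] be open and nonempty, and put
    [U := \bigcup_t t O], which is open and satisfies [t U `<=` U].  The
    sets [t^-1 U] cover [X], hence so do finitely many [t_i^-1 U]; for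
    [s = r_i t_i] in all the [T t_i], [s X `<=` U], so [U = X], i.e., every
    reflected orbit meets [O].  The converse is the same argument for the
    inverse maps.

    If [T] is compact, each [t] has an [r] such that [t r] acts trivially, so
    that the orbits of [(T, X)] and those of its reflection coincide. *)
Require Import Defs.
From mathcomp Require Import all_boot boolp classical_sets functions topology.

Local Open Scope classical_set_scope.

(* [compact_cover] requires a pointed space. *)
Lemma compact_seq_cover (X : topologicalType) (I : eqType) (V : I -> set X) :
  compact [set: X] -> (forall i, open (V i)) -> (forall x, exists i, V i x) ->
  exists D : seq I, forall x, exists2 i, i \in D & V i x.
Proof.
move=> /compact_near_coveringP Xc V_open V_cover.
(* Lists are ordered by inclusion: each point has a neighbourhood covered by all large enough lists,
   and compactness makes this uniform over [X]. *)
pose above (D : seq I) := [set E : seq I | {subset D <= E}].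
pose G := filter_from [set: seq I] above.
have GF : Filter G.
  apply: filter_from_filter; first by exists [::].
  move=> D E _ _; exists (D ++ E) => // B DEB.
  by split=> i Bi; apply: DEB; rewrite mem_cat Bi ?orbT.
pose covered (E : seq I) x := exists2 i, i \in E & V i x.
have [x _|D _ GD] := Xc _ G covered GF.
  have [i Vix] := V_cover x.
  exists (V i, above [:: i]) => /=.
    by split; [exact: open_nbhs_nbhs | exists [:: i]].
  by move=> [y E] /= [Viy iE]; exists i => //; apply: iE; exact: mem_head.
by exists D => x; exact: (GD D).
Qed.

(** The product [m] is abstract so that both directions are instances: the reflected maps compose by
    the opposite multiplication. *)
Lemma dense_orbits_inverse (I : eqType) (X : topologicalType)
    (m : I -> I -> I) (f g : I -> X -> X) :
  compact [set: X] ->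
  (forall i, continuous (f i)) -> (forall i, continuous (g i)) ->
  (forall i, cancel (f i) (g i)) -> (forall i, cancel (g i) (f i)) ->
  (forall i j x, f i (f j x) = f (m i j) x) ->
  (forall D : seq I, exists s, forall i, i \in D -> exists r, m r i = s) ->
  (forall x, dense [set f i x | i in [set: I]]) ->
  forall x, dense [set g i x | i in [set: I]].
Proof.
move=> Xc fc gc fK gK fM meet f_dense x O [o Oo] O_open.
pose U := \bigcup_(i in [set: I]) (g i @^-1` O).
have U_open : open U.
  by apply: bigcup_open => i _; apply: open_comp => // y _; exact: gc.
have fU j y : U y -> U (f j y).
  move=> [i _ Oy]; exists (m j i) => //=.
  by rewrite -(gK i y) fM fK.
have U_cover y : exists i, (f i @^-1` U) y.
  suff /(f_dense y)/(_ U_open)[z [Uz [i _ fiy]]] : U !=set0.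
    by exists i => //=; rewrite fiy.
  (* The empty list merely provides some index, as [I] is not assumed inhabited. *)
  have [s _] := meet [::].
  by exists (f s o), s => //=; rewrite fK.
have U_pre_open i : open (f i @^-1` U).
  by apply: open_comp => // y _; exact: fc.
have [D DU] := compact_seq_cover _ _ _ Xc U_pre_open U_cover.
have [s sD] := meet D.
have [i Di Ui] := DU (g s x).
have [r rs] := sD i Di.
(* With [s = m r i], [x = f r (f i (g s x))]; here [f i (g s x)] lies in [U], which [f r]
   preserves. *)
have [j _ Oj] : U x by rewrite -(gK s x) -rs -fM rs; exact: fU.
by exists (g j x); split=> //; exists j.
Qed.

Lemma cofinite_meet (T : topologicalType) (I : choiceType) (A : I -> set T) :
  ~ compact [set: T] -> (forall i, precompact ([set: T] `\` A i)) ->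
  forall D : seq I, exists s, forall i, i \in D -> A i s.
Proof.
move=> Tnc Apc D; apply: contrapT => /forallNP noS; apply: Tnc.
have Dc : compact (\big[setU/set0]_(i <- D) closure ([set: T] `\` A i)).
  by apply: bigsetU_compact => i _; rewrite -precompactE.
apply: (subclosed_compact _ Dc); first exact: closedT.
move=> s _; rewrite -bigcup_seq.
have /existsNP[i /not_implyP[Di nA]] := noS s.
by exists i => //; apply: subset_closure.
Qed.

(** The preimage of a closed set under [g] is its image under [f], which is compact and hence
    closed. *)
Lemma compact_inverse_continuous (X : topologicalType) (f g : X -> X) :
  compact [set: X] -> hausdorff_space X -> continuous f ->
  cancel f g -> cancel g f -> continuous g.
Proof.
move=> Xc Xh fc fK gK; apply/continuous_closedP => A A_closed.
have -> : g @^-1` A = f @` A.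
  apply/seteqP; split=> [y Ay|_ [z Az <-]] /=; last by rewrite fK.
  by exists (g y).
apply: compact_closed => //; apply: continuous_compact.
  exact: continuous_subspaceT.
exact: subclosed_compact Xc _.
Qed.

(* [ultra_image] requires a surjective map. *)
Lemma ultra_fmap (T U : Type) (f : T -> U) (F : set_system T) :
  UltraFilter F -> UltraFilter (f @ F).
Proof.
move=> FU; split=> [|G GF FG]; first exact: fmap_proper_filter.
apply/seteqP; split=> // A GA.
have [//|FnA] := in_ultra_setVsetC (f @^-1` A) FU.
by have /filter_ex[y []] : G (A `&` ~` A) by apply: filterI => //; exact: FG.
Qed.

Lemma cvg_mulg (T : topologicalSemigroupType) (I : Type) (F : set_system I)
    (f g : I -> T) (a b : T) :
  Filter F -> f @ F --> a -> g @ F --> b -> (f i * g i)%g @[i --> F] --> (a * b)%g.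
Proof.
move=> FF; apply: (@continuous2_cvg _ _ _ _ _ _ f g (fun x y : T => (x * y)%g)).
exact: (mulg_continuous (a, b)).
Qed.

(* [t ^ m.+1 * r_m = p] for some [r_m], where [p] is the limit of [t ^ m]
   along a free ultrafilter; take [r := lim r_m]. *)
Lemma compact_semigroup_regular (T : topologicalSemigroupType) (t : T) :
  compact [set: T] -> exists p r : T, (p * (t * r) = p)%g.
Proof.
move=> Tc; have Th := @topsemigroup_hausdorff T.
have [F [FU F_free]] := ultraFilterLemma eventually_filter.
have lim_F (u : nat -> T) : exists l : T, u @ F --> l.
  have u_ultra : UltraFilter (u @ F) by exact: ultra_fmap.
  have Tu := Tc; rewrite compact_ultra in Tu.
  by have [l [_ ul]] := Tu _ u_ultra filterT; exists l.
have [p pF] := lim_F (fun m => (t ^+ m)%g).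
have /choice[r rE] : forall m, exists r, (t ^+ m.+1 * r = p)%g.
  (* The right ideal [A] is compact, hence closed, and contains [t ^+ n] for all [n > m], so it
     contains the limit [p]. *)
  move=> m; pose A := [set (t ^+ m.+1 * r)%g | r in [set: T]].
  suff : A p by case=> r _ <-; exists r.
  apply: (closed_cvg A _ _ _ pF).
    apply: compact_closed => //; apply: continuous_compact => //.
    apply: continuous_subspaceT => r.
    by apply: cvg_mulg => //; exact: cvg_cst.
  apply: F_free; exists m.+1 => // n /= mn.
  by exists (t ^+ (n - m.+1))%g => //; rewrite -expgnDr subnKC.
have [q qF] := lim_F r; exists p, q.
have trF : (t * r m)%g @[m --> F] --> (t * q)%g.
  by apply: cvg_mulg => //; exact: cvg_cst.
have prF : (t ^+ m * (t * r m))%g @[m --> F] --> (p * (t * q))%g.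
  exact: cvg_mulg.
apply: (cvg_unique _ prF) => //.
rewrite (_ : (fun m => _) = fun=> p); first exact: cvg_cst.
by apply/funext => m; rewrite mulgA -expgSr rE.
Qed.

Theorem mainTheorem11 (T : topologicalSemigroupType) (X : topologicalType)
    (act : T -> X -> X)
    (X_nonempty : [set: X] !=set0)
    (X_compact : compact [set: X])
    (X_hausdorff : hausdorff_space X)
    (T_C : C_semigroup T)
    (act_semiflow : semiflow act)
    (act_invertible : invertible act) :
  minimal act <-> right_minimal (reflection act).
Proof.
have [act_cont _ actM] := act_semiflow.
have actK t : cancel (act t) (reflection act ^~ t).
  by move=> x; exact: reflectionVK.
have reflK t : cancel (reflection act ^~ t) (act t).
  by move=> x; exact: reflectionK.
have act_cts t : continuous (act t).
  move=> x; apply: (@continuous2_cvg _ _ _ _ _ _ (fun=> t) id act t x).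
  - exact: (act_cont (t, x)).
  - exact: cvg_cst.
  - exact: cvg_id.
have refl_cts t : continuous (reflection act ^~ t).
  exact: compact_inverse_continuous (act_cts t) _ _.
have reflM s t x :
    reflection act (reflection act x t) s = reflection act x (t * s)%g.
  by rewrite -[x in LHS](reflK (t * s)%g) -actM !actK.
have [Tc|Tnc] := pselect (compact [set: T]).
  have inv t : exists r, forall x, act t (act r x) = x.
    have [p [r prE]] := compact_semigroup_regular _ t Tc.
    (* Injectivity of [act p] cancels [p] in [p * (t * r) = p]. *)
    exists r => x; apply: (can_inj (actK p)).
    by rewrite !actM -mulgA prE.
  have orbitE x :
      [set act t x | t in [set: T]] = [set reflection act x t | t in [set: T]].
    apply/seteqP; split=> _ [t _ <-]; have [r trK] := inv t; exists r => //.
      (* A right inverse of the injective map [act t] is also a left inverse. *)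
      have rtK : act r (act t x) = x by apply: (can_inj (actK t)); exact: trK.
      by rewrite -[in LHS]rtK actK.
    by rewrite -[act r x](actK t) trK.
  by rewrite /minimal /right_minimal; split=> + x => /(_ x); rewrite orbitE.
split.
  apply: (dense_orbits_inverse _ _ (fun s t => (s * t)%g)) => // D.
  have [s sD] := cofinite_meet _ _ _ Tnc (fun t => (T_C t).2) D.
  by exists s => i /sD[r _ <-]; exists r.
(* For the reflected maps the ideals that must meet are [t T] instead of [T t]. *)
apply: (dense_orbits_inverse _ _ (fun s t => (t * s)%g)) => // D.
have [s sD] := cofinite_meet _ _ _ Tnc (fun t => (T_C t).1) D.
by exists s => i /sD[r _ <-]; exists r.
Qed.
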